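(* For every tree $t$ on $n$ vertices, $$D_{max}^t \ge D_{max}^{star} = \binom n2,$$ where $D_{max}^{star}$ is $D_{max}$ of the star tree on $n$ vertices.
   Context: A linear arrangement of a tree on $n$ vertices is a bijection $\pi$ from its vertex set to $\{1,\dots,n\}$; $D(\pi)=\sum_{\{u,v\}\in E}|\pi(u)-\pi(v)|$, and $D_{max}^t$ is the maximum of $D(\pi)$ over all linear arrangements of $t$. The star tree on $n$ vertices has one vertex adjacent to all other $n-1$ vertices. *)

(* Defs.v *)
From mathcomp Require Import all_boot all_order all_algebra.

Set Implicit Arguments.
Unset Strict Implicit.
Unset Printing Implicit Defensive.

(* A finite simple graph on T is given by its adjacency relation. *)
Definition simple_graph (T : finType) (e : rel T) : Prop :=
  symmetric e /\ irreflexive e.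

Definition connected_graph (T : finType) (e : rel T) : Prop :=
  0 < #|T| /\ forall u v : T, connect e u v.

(* A graph cycle is a duplicate-free closed walk through at least 3 vertices;
   with fewer vertices, a ucycle only goes back and forth along one edge. *)
Definition acyclic_graph (T : finType) (e : rel T) : Prop :=
  forall c : seq T, ucycle e c -> size c < 3.

Definition is_tree (T : finType) (e : rel T) : Prop :=
  [/\ simple_graph e, connected_graph e & acyclic_graph e].

(* The vertex 0 is the centre. *)
Definition star (n : nat) : rel 'I_n :=
  fun u v => (u != v) && ((val u == 0) || (val v == 0)).

Definition bijectionb (A B : finType) (f : {ffun A -> B}) : bool :=
  injectiveb f && [forall b : B, exists a : A, f a == b].

(* The position of v in {1, ..., n} is the successor of pi v : 'I_n. *)
Definition position (T : finType) (pi : {ffun T -> 'I_#|T|}) (v : T) : nat :=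
  (pi v).+1.

(* Comparing the ranks of u and v in the enumeration of T makes each unordered
   edge {u, v} count exactly once. *)
Definition D (T : finType) (e : rel T) (pi : {ffun T -> 'I_#|T|}) : nat :=
  \sum_(u : T) \sum_(v : T | (enum_rank u < enum_rank v) && e u v)
    `|position pi u - position pi v|%N.

Definition Dmax (T : finType) (e : rel T) : nat :=
  \max_(pi : {ffun T -> 'I_#|T|} | bijectionb pi) D e pi.

(* The set of arrangements is nonempty, so that the maximum is attained. *)
Lemma Dmax_attained (T : finType) (e : rel T) :
  exists2 pi : {ffun T -> 'I_#|T|}, bijectionb pi & Dmax e = D e pi.
Proof.
pose pi0 : {ffun T -> 'I_#|T|} := [ffun v => enum_rank v].
have b0 : bijectionb pi0.
  apply/andP; split.
    by apply/injectiveP => u v; rewrite !ffunE => /enum_rank_inj.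
  by apply/forallP => i; apply/existsP; exists (enum_val i); rewrite ffunE enum_valK.
by rewrite /Dmax (bigmax_eq_arg _ b0); case: arg_maxnP => // pi bpi _; exists pi.
Qed.

Lemma star_is_tree (n : nat) : 0 < n -> is_tree (@star n).
Proof.
case: n => // n _; have starC : symmetric (@star n.+1).
  by move=> u v; rewrite /star eq_sym orbC.
split; first by split=> // u; rewrite /star eqxx.
  split=> [|u v]; first by rewrite card_ord.
  have to0 w : connect (@star n.+1) w ord0.
    by have [->|w0] := eqVneq w ord0; rewrite ?connect0 // connect1 // /star w0 orbT.
  apply: connect_trans (to0 u) _.
  by have [->|v0] := eqVneq v ord0; rewrite ?connect0 // connect1 // /star eq_sym v0.
case=> [|a [|b [|c s]]] //= /andP[/= /and3P[/andP[_ ab] /andP[_ bc] cs]].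
rewrite !inE !negb_or => /and4P[/and3P[nab nac _] /andP[nbc nbs] _ _].
have b0 : val b = 0.
  apply/eqP; apply: contraT => nb0.
  move: ab bc nac; rewrite (negbTE nb0) orbF /= => /eqP a0 /eqP c0.
  by rewrite -val_eqE /= a0 c0.
have c_n0 : val c != 0 by apply: contra nbc => /eqP c0; rewrite -val_eqE /= b0 c0.
have : b \in rcons s a.
  case: s cs {nbs} => [|d s] /= /andP[/andP[_]]; rewrite (negbTE c_n0) /= => /eqP d0 _;
  by rewrite inE -val_eqE /= b0 d0.
by rewrite mem_rcons inE eq_sym (negbTE nab) (negbTE nbs).
Qed.

(* Main.v *)
Require Import Defs.
From mathcomp Require Import all_boot all_order all_algebra.
From mathcomp Require Import zify.

(** A breadth-first search from a vertex [r] gives every other vertex [v] a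
    parent at distance one less, hence [n - 1] distinct edges, properly coloured
    by the parity of the distance to [r].  Put one colour class before the
    other: reversing both classes gives a second arrangement, and the two
    lengths of an edge between the classes add up to [n].  So the two costs add
    up to at least [n (n - 1)], and one of them is at least ['C(n, 2)].
    For the star, if the centre is at [i], the two vertices at [j] and
    [n - 1 - j] are together at distance at most [n - 1] from it; summing over
    [j] bounds twice the cost by [n (n - 1)]. *)

Lemma double_bin2 n : 2 * 'C(n, 2) = n * n.-1.
Proof.
by rewrite bin2 mul2n halfK; case: n => // n; rewrite oddM /= andNb subn0.
Qed.

Lemma bijectionb_inj (T : finType) (pi : {ffun T -> 'I_#|T|}) :
  injective pi -> bijectionb pi.
Proof.
move=> pi_inj; apply/andP; split; first exact/injectiveP.
apply/forallP => i; apply/existsP.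
have /codomP[v ->] : i \in codom pi by apply: inj_card_onto; rewrite ?card_ord.
by exists v.
Qed.

Lemma arrangement_of_nat {T : finType} {g : T -> nat} :
    injective g -> (forall v, g v < #|T|) ->
  exists2 pi : {ffun T -> 'I_#|T|}, bijectionb pi & forall v, pi v = g v :> nat.
Proof.
move=> g_inj g_lt; exists [ffun v => Ordinal (g_lt v)] => [|v]; last by rewrite ffunE.
by apply: bijectionb_inj => u v; rewrite !ffunE => -[/g_inj].
Qed.

(** Ordered pairs meet every edge from both ends, which frees the cost from the order of the
    enumeration. *)
Lemma double_D (T : finType) (e : rel T) (pi : {ffun T -> 'I_#|T|}) :
    simple_graph e ->
  2 * D e pi = \sum_u \sum_(v | e u v) `|position pi u - position pi v|%N.
Proof.
move=> [eC e_irr]; rewrite mul2n -addnn {2}/D (exchange_big_dep predT) //= -big_split /=.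
apply: eq_bigr => u _.
rewrite [RHS](bigID (fun v => enum_rank u < enum_rank v)) /=; congr (_ + _).
  by apply: eq_bigl => v; rewrite andbC.
apply: eq_big => [v|v _]; last by rewrite distnC.
rewrite eC -leqNgt [in RHS]leq_eqVlt andbC; case euv: (e u v) => //=.
suff /negbTE -> : enum_rank v != enum_rank u :> nat by [].
by apply: contraTneq euv => /val_inj/enum_rank_inj->; rewrite e_irr.
Qed.

(** Take for [d v] the least length of a walk from [r] to [v], and for [par v] the last vertex but
    one of a shortest walk. *)
Lemma connected_bfs {T : finType} {e : rel T} (r : T) :
    (forall v, connect e r v) ->
  exists (d : T -> nat) (par : T -> T),
    forall v, v != r -> e (par v) v /\ d v = (d (par v)).+1.
Proof.
move=> e_conn.
pose P v k := [exists p : k.-tuple T, path e r p && (last r p == v)].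
have exP v : exists k, P v k.
  have /connectP[p p_path ->] := e_conn v.
  by exists (size p); apply/existsP; exists (in_tuple p); rewrite p_path eqxx.
have PP v p : path e r p -> last r p = v -> P v (size p).
  by move=> pp lp; apply/existsP; exists (in_tuple p); rewrite pp lp eqxx.
pose d v := ex_minn (exP v).
have d_le v k : P v k -> d v <= k by rewrite /d; case: ex_minnP => m _; apply.
have dP v : exists p, [/\ path e r p, last r p = v & size p = d v].
  rewrite /d; case: ex_minnP => k /existsP[p /andP[pp /eqP lp]] _.
  by exists p; rewrite size_tuple.
(* Stated as a boolean implication, the claim also holds at [r], so [xchoose] can define the parent
   on all of [T]. *)
have parP v : exists u, (v != r) ==> e u v && (d v == (d u).+1).
  have [->|v_r] := eqVneq v r; first by exists r.
  have [p [+ lp sp]] := dP v; case/lastP: p lp sp => [/= rv|p w].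
    by rewrite rv eqxx in v_r.
  rewrite last_rcons size_rcons rcons_path => -> sp /andP[pp lpv].
  exists (last r p); rewrite lpv /=.
  have du_le := d_le _ _ (PP _ _ pp erefl).
  have [q [qp lq sq]] := dP (last r p).
  (* Extending a shortest walk to the parent by [v] bounds [d v] by one more than the parent's
     distance. *)
  have : d v <= size (rcons q v).
    by apply/d_le/PP; rewrite ?last_rcons // rcons_path qp lq.
  by rewrite size_rcons; lia.
exists d, (fun v => xchoose (parP v)) => v v_r.
by have /implyP/(_ v_r)/andP[-> /eqP] := xchooseP (parP v).
Qed.

Lemma sum_parents_le_D {T : finType} {e : rel T} {r : T} {d : T -> nat}
    {par : T -> T} (pi : {ffun T -> 'I_#|T|}) :
    simple_graph e ->
    (forall v, v != r -> e (par v) v /\ d v = (d (par v)).+1) ->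
  \sum_(v | v != r) `|position pi (par v) - position pi v|%N <= D e pi.
Proof.
move=> e_simple parP; have eC := e_simple.1.
rewrite -(leq_pmul2l (isT : 0 < 2)) double_D //.
set f := fun u v => `|position pi u - position pi v|%N.
have fC u v : f u v = f v u by rewrite /f distnC.
set S := \sum_(v | _) _.
(* [S] is spread over ordered pairs in both orientations, to be compared term by term with the
   doubled cost. *)
have S1 : S = \sum_u \sum_v ((v != r) && (u == par v)) * f u v.
  rewrite exchange_big /= /S big_mkcond /=; apply: eq_bigr => v _.
  case: eqP => _ /=; first by rewrite big1.
  rewrite (bigD1 (par v)) //= eqxx mul1n big1 ?addn0 // => u /negbTE->.
  by rewrite mul0n.
have S2 : S = \sum_u \sum_v ((u != r) && (v == par u)) * f u v.
  rewrite S1 exchange_big; apply: eq_bigr => u _; apply: eq_bigr => v _.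
  by rewrite fC.
rewrite mul2n -addnn {1}S1 S2 -big_split; apply: leq_sum => u _.
rewrite -big_split /= [leqRHS]big_mkcond; apply: leq_sum => v _.
rewrite -mulnDl -/(f u v).
(* Two vertices are never each other's parents, as [d u] and [d v] would each exceed the other; so
   no edge is counted twice. *)
have [/andP[v_r /eqP u_par]|_] := boolP ((v != r) && _);
  have [/andP[u_r /eqP v_par]|_] := boolP ((u != r) && _) => //.
- have [_] := parP v v_r; have [_] := parP u u_r; rewrite -u_par -v_par; lia.
- by have [+ _] := parP v v_r; rewrite -u_par => ->; rewrite addn0 mul1n.
- by have [+ _] := parP u u_r; rewrite -v_par eC => ->; rewrite mul1n.
Qed.

Lemma two_block_arrangements {T : finType} (c : pred T) :
  exists pi pi' : {ffun T -> 'I_#|T|},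
    [/\ bijectionb pi, bijectionb pi' &
      forall u v, c u != c v ->
        `|position pi u - position pi v|%N +
        `|position pi' u - position pi' v|%N = #|T|].
Proof.
pose s1 := filter c (enum T); pose s2 := filter (predC c) (enum T).
pose a := size s1.
have s_perm : perm_eq (s1 ++ s2) (enum T) by rewrite perm_filterC.
have s_mem v : v \in s1 ++ s2 by rewrite (perm_mem s_perm) mem_enum.
have s_size : a + size s2 = #|T| by rewrite -size_cat (perm_size s_perm) -cardE.
pose g v := index v (s1 ++ s2).
have g_inj : injective g by move=> u v; apply: index_inj.
have gP v : if c v then g v < a else a <= g v < #|T|.
  have : g v < #|T| by rewrite -s_size -size_cat index_mem.
  have s1E : (v \in s1) = c v by rewrite mem_filter mem_enum andbT.
  rewrite /g index_cat s1E; case cv: (c v) => g_lt; first by rewrite index_mem s1E.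
  by rewrite leq_addr.
have a_le : a <= #|T| by rewrite -s_size leq_addr.
(* Each block, below [a] and from [a] on, is reflected in itself. For [u] in the first and [v] in
   the second, the gap [g v - g u] becomes [#|T| - (g v - g u)]. *)
pose g' v := if c v then a - (g v).+1 else a + #|T| - (g v).+1.
have g'_inj : injective g'.
  move=> u v; rewrite /g' => guv; apply: g_inj.
  by have := gP u; have := gP v; move: guv; case: (c u); case: (c v); lia.
have [v|pi pi_bij piE] := arrangement_of_nat g_inj.
  by have := gP v; case: (c v); lia.
have [v|pi' pi'_bij pi'E] := arrangement_of_nat g'_inj.
  by have := gP v; rewrite /g'; case: (c v); lia.
exists pi, pi'; split=> // u v; rewrite /position !piE !pi'E /g'.
by have := gP u; have := gP v; case: (c u); case: (c v) => //; lia.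
Qed.

Lemma Dmax_connected_ge {T : finType} {e : rel T} :
  simple_graph e -> connected_graph e -> 'C(#|T|, 2) <= Dmax e.
Proof.
move=> e_simple [/card_gt0P[r _] e_conn].
have [d [par parP]] := connected_bfs r (e_conn r).
have [pi [pi' [pi_bij pi'_bij piP]]] := two_block_arrangements (fun v => odd (d v)).
have le1 := sum_parents_le_D pi e_simple parP.
have le2 := sum_parents_le_D pi' e_simple parP.
have ge1 : D e pi <= Dmax e := leq_bigmax_cond _ pi_bij.
have ge2 : D e pi' <= Dmax e := leq_bigmax_cond _ pi'_bij.
rewrite -(leq_pmul2l (isT : 0 < 2)) double_bin2.
apply: leq_trans (_ : D e pi + D e pi' <= _); last by lia.
apply: leq_trans (leq_add le1 le2); rewrite -big_split /=.
(* Parent and child have distances of opposite parity, hence lie in different blocks: each parent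
   edge contributes [#|T|] to the two costs together. *)
rewrite (eq_bigr (fun=> #|T|)) => [|v /parP[_ dv]].
  by rewrite sum_nat_const cardC1 mulnC.
by apply: piP; rewrite dv /=; case: odd.
Qed.

Lemma sum_distn_le {m i} : i < m -> \sum_(j < m) `|i - j|%N <= 'C(m, 2).
Proof.
move=> i_m; rewrite -(leq_pmul2l (isT : 0 < 2)) double_bin2 mul2n -addnn.
(* Reversal pairs [j] with [m - 1 - j]. Their distances to [i] add up to [|m - 1 - 2j|] if [i] lies
   between them, and to [|2i - (m - 1)|] otherwise. *)
rewrite {2}(reindex_inj rev_ord_inj) -big_split /=.
rewrite -[X in X * _]card_ord -sum_nat_const.
by apply: leq_sum => j _; have := ltn_ord j; lia.
Qed.

Lemma D_star_le n (pi : {ffun 'I_n -> 'I_#|'I_n|}) :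
  0 < n -> bijectionb pi -> D (@star n) pi <= 'C(n, 2).
Proof.
case: n pi => // n pi _ /andP[/injectiveP pi_inj _].
rewrite -(leq_pmul2l (isT : 0 < 2)) double_D; last first.
  by case: (@star_is_tree n.+1 isT).
set f := fun u v => `|position pi u - position pi v|%N.
have fC u v : f u v = f v u by rewrite /f distnC.
have f_le : \sum_v f ord0 v <= 'C(n.+1, 2).
  rewrite -[X in 'C(X, 2)]card_ord; apply: leq_trans (sum_distn_le (ltn_ord (pi ord0))).
  (* Bijectivity turns the sum over vertices into a sum over all positions. *)
  have [pi1 pi1K pi1K'] : bijective pi by apply: inj_card_bij; rewrite ?card_ord.
  rewrite [leqRHS](reindex pi) /=; last by exists pi1 => x _.
  by apply: leq_sum => v _; rewrite /f /position -[leqRHS](distnDr 1) !addn1.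
(* The row of the centre counts every edge once; the other rows, where the centre is the only
   neighbour, count them again. *)
apply: leq_trans (_ : \sum_v f ord0 v + \sum_v f ord0 v <= _); last by lia.
rewrite big_ord_recl; apply: leq_add.
  by rewrite big_mkcond; apply: leq_sum => v _; case: ifP.
rewrite [leqRHS]big_ord_recl; apply: leq_trans (leq_addl _ _).
apply: leq_sum => u _; rewrite (big_pred1 ord0) => [|v]; first by rewrite -/(f _ _) fC.
rewrite /star /= -!val_eqE /=; case: (val v) => //.
by move=> k; rewrite andbF.
Qed.

Theorem theorem6 (n : nat) (T : finType) (t : rel T) :
  #|T| = n -> is_tree t ->
  Dmax t >= Dmax (@star n) /\ Dmax (@star n) = 'C(n, 2).
Proof.
move=> cardT [t_simple t_conn _]; have n_gt0 : 0 < n by rewrite -cardT; case: t_conn.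
have starE : Dmax (@star n) = 'C(n, 2).
  apply/eqP; rewrite eqn_leq; apply/andP; split.
    by apply/bigmax_leqP => pi; apply: D_star_le.
  have [star_simple star_conn _] := star_is_tree n_gt0.
  by have := Dmax_connected_ge star_simple star_conn; rewrite card_ord.
by split=> //; rewrite starE -cardT; apply: Dmax_connected_ge.
Qed.
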